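(* For every integer $k\ge1$ there is a $(6k+2)\,CCZ\to 2k\,CCZ$ distillation protocol at distance $2$, given by the following matrix over $\mathbb F_8$. Let $$L=\begin{pmatrix}0&1\\0&1\end{pmatrix},\quad M=\begin{pmatrix}\alpha^2&\alpha^4&\alpha^6&\alpha^8&\alpha^{10}&\alpha^{12}\\\alpha&\alpha^2&\alpha^3&\alpha^4&\alpha^5&\alpha^6\end{pmatrix},\quad S=\begin{pmatrix}1&1&1&1&1&1\\1&1&1&1&1&1\end{pmatrix},\quad\mathbf 1_6=(1\,1\,1\,1\,1\,1),$$ and let $G\in\mathbb F_8^{(2k+1)\times(6k+2)}$ be $$G=\left(\begin{array}{cccccc}L&M&0&0&\cdots&0\\L&S&M&0&\cdots&0\\L&S&S&M&\cdots&0\\\vdots&\vdots&\vdots&\vdots&\ddots&\vdots\\L&S&S&S&\cdots&M\\\hline1\;1&\mathbf 1_6&\mathbf 1_6&\mathbf 1_6&\cdots&\mathbf 1_6\end{array}\right),$$ with $k$ block rows above the line (so $2k$ logical rows) and one stabilizer row. Then $G$ has full rank and satisfies $$\sum_i(g_{a,i})^4(g_{b,i})^2g_{c,i}=\begin{cases}1&1\le a=b=c\le 2k\\0&\text{otherwise}\end{cases}\qquad(1\le a,b,c\le 2k+1);$$ consequently applying the norm gate $N$ (which is $CCZ$ up to Pauli operators) to each of the $6k+2$ physical qudits acts on the code as the logical $N^{\otimes 2k}$; and the $Z$-distance of the code is $2$.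
   Context: $\mathbb F_8=\mathbb F_2(\alpha)$ with $\alpha^3=\alpha+1$. An $\mathbb F_8$-qudit, with basis $|\gamma\rangle$, $\gamma\in\mathbb F_8$, is identified with three qubits via an $\mathbb F_2$-basis of $\mathbb F_8$. The norm gate is $N|\gamma\rangle=(-1)^{\gamma^7}|\gamma\rangle$ ($\gamma^7\in\{0,1\}$); up to global phase it equals $X^{\otimes3}\,CCZ\,X^{\otimes3}$ on the three qubits. A full-rank matrix $G\in\mathbb F_8^{m\times n}$ with rows $\mathbf g_1,\dots,\mathbf g_m$ and $k'$ logical rows defines a CSS code on $n$ qudits: the first $k'$ rows are $X$-logical operators, the remaining rows generate the $X$-stabilizer space $\mathcal G_0$; logical basis states are $|\overline u\rangle\propto\sum_{\mathbf g\in\mathcal G_0}|\sum_{a\le k'}u_a\mathbf g_a+\mathbf g\rangle$, $u\in\mathbb F_8^{k'}$. ''Acts as the logical $N^{\otimes k'}$'' means $N^{\otimes n}|\overline u\rangle=(-1)^{\sum_{a\le k'}u_a^7}|\overline u\rangle$ for all $u$. The $Z$-distance is the minimum Hamming weight (number of nonzero $\mathbb F_8$-coordinates) of a vector orthogonal (for $\sum x_iy_i$) to all stabilizer rows but not to at least one logical row. An ''$n\,CCZ\to k'\,CCZ$ protocol at distance $d$'' is such a matrix with this logical action and $Z$-distance $d$. *)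

(* Defs.v *)
From mathcomp Require Import all_boot all_order all_algebra all_field.

Set Implicit Arguments.
Unset Strict Implicit.
Unset Printing Implicit Defensive.

Import Order.TTheory GRing.Theory Num.Theory.
Local Open Scope ring_scope.

(* Amplitudes live in an arbitrary algebraically closed field with            *)
(* conjugation and norm (the complex numbers R[i], algC, ...).                *)
Section Quantum.
Variable C : numClosedFieldType.

(* A system whose computational basis is labelled by the finite type T has    *)
(* state space C^T; n copies of a system with basis B are labelled by the     *)
(* words 'rV[B]_n.                                                            *)
Definition state (T : finType) := {ffun T -> C^o}.

Definition ket (T : finType) (x : T) : state T := [ffun y => (y == x)%:R].

(* Operators are given by their matrix elements: A x y = <x|A|y>.             *)
Definition operator (T : finType) := T -> T -> C.

Definition apply_op (T : finType) (A : operator T) (psi : state T) : state T :=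
  [ffun x => \sum_(y : T) A x y * psi y].

Definition comp_op (T : finType) (A B : operator T) : operator T :=
  fun x y => \sum_(z : T) A x z * B z y.

Definition tensor_pow (B : finType) (n : nat) (A : operator B) :
    operator 'rV[B]_n :=
  fun x y => \prod_(i < n) A (x 0 i) (y 0 i).

Definition eq_up_to_phase (T : finType) (A B : operator T) : Prop :=
  exists w : C, `|w| = 1 /\ forall x y, A x y = w * B x y.

Definition gate_X : operator bool := fun x y => (x == ~~ y)%:R.

Definition gate_CCZ : operator 'rV[bool]_3 :=
  fun x y => (-1) ^+ [forall i, y 0%R i] * (x == y)%:R.

Section Codes.
Variable F : finFieldType.

(* For #|F| = 8, x ^+ 7 is 0 or 1; this is its lift to a natural number, so   *)
(* that it can be used as an exponent of -1.                                  *)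
Definition pow7 (x : F) : nat := x ^+ 7 == 1.

Definition gate_N : operator F :=
  fun x y => (-1) ^+ pow7 y * (x == y)%:R.

Definition from_bits (e : 'I_3 -> F) (b : 'rV[bool]_3) : F :=
  \sum_(i < 3) (b 0 i)%:R * e i.

(* In characteristic 2: every element is a unique F_2-combination of the e i. *)
Definition F2_basis (e : 'I_3 -> F) : Prop := bijective (from_bits e).

(* The operator on three qubits corresponding to an operator on an F-qudit.   *)
Definition on_qubits (e : 'I_3 -> F) (A : operator F) : operator 'rV[bool]_3 :=
  fun x y => A (from_bits e x) (from_bits e y).

(* The CSS code of G : 'M[F]_(k' + s, n): the first k' rows (usubmx G) are    *)
(* the X-logical operators, the last s rows (dsubmx G) are the X-stabilizer   *)
(* generators.                                                                *)
Section CSS.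
Variables (n k' s : nat) (G : 'M[F]_(k' + s, n)).

Definition stab_space : {set 'rV[F]_n} := [set g | (g <= dsubmx G)%MS].

(* u *m usubmx G = \sum_a u_a g_a.                                            *)
Definition logical_ket (u : 'rV[F]_k') : state 'rV[F]_n :=
  (sqrtC (#|stab_space|%:R : C))^-1 *:
    \sum_(g in stab_space) ket (u *m usubmx G + g).

Definition acts_as_logical_N : Prop :=
  forall u : 'rV[F]_k',
    apply_op (tensor_pow gate_N) (logical_ket u)
    = (-1) ^+ (\sum_(a < k') pow7 (u 0%R a)) *: logical_ket u.

Definition hamming_weight (z : 'rV[F]_n) : nat := #|[set i | z 0 i != 0]|.

Definition orthogonal_row (z : 'rV[F]_n) (r : 'I_(k' + s)) : Prop :=
  \sum_(i < n) z 0 i * G r i = 0.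

Definition Z_logical (z : 'rV[F]_n) : Prop :=
  (forall j : 'I_s, orthogonal_row z (rshift k' j))
  /\ (exists a : 'I_k', ~ orthogonal_row z (lshift s a)).

Definition Z_distance_is (d : nat) : Prop :=
  (exists2 z, Z_logical z & hamming_weight z = d)
  /\ (forall z, Z_logical z -> (d <= hamming_weight z)%N).

End CSS.

(* G is an n CCZ -> k' CCZ protocol at distance d.                            *)
Definition CCZ_protocol (n k' d s : nat) (G : 'M[F]_(k' + s, n)) : Prop :=
  [/\ row_free G, acts_as_logical_N G & Z_distance_is G d].

End Codes.
End Quantum.

Arguments gate_X C : clear implicits.
Arguments gate_CCZ C : clear implicits.
Arguments gate_N C F : clear implicits.
Arguments acts_as_logical_N C {F n k' s} G.
Arguments CCZ_protocol C {F} n k' d {s} G.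

Section Matrices.
Variables (F : finFieldType) (alpha : F).

Definition blockL : 'M[F]_(2, 2) := \matrix_(i, j) (j == 1)%:R.

Definition blockM : 'M[F]_(2, 6) :=
  \matrix_(i, j) if i == 0 then alpha ^+ (2 * j.+1) else alpha ^+ j.+1.

Definition blockS : 'M[F]_(2, 6) := const_mx 1.

(* Row r is row r %% 2 of block row r %/ 2; after the first two columns,      *)
(* column c is column (c - 2) %% 6 of block column (c - 2) %/ 6.              *)
Definition logical_rows (k : nat) : 'M[F]_(2 * k, 6 * k + 2) :=
  \matrix_(r, c)
    if (c < 2)%N then blockL (inord (r %% 2)) (inord c)
    else
      let p := (r %/ 2)%N in
      let q := ((c - 2) %/ 6)%N in
      if (q < p)%N then blockS (inord (r %% 2)) (inord ((c - 2) %% 6))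
      else if q == p then blockM (inord (r %% 2)) (inord ((c - 2) %% 6))
      else 0.

Definition Gmatrix (k : nat) : 'M[F]_(2 * k + 1, 6 * k + 2) :=
  col_mx (logical_rows k) (const_mx 1).

End Matrices.

(* Main.v *)
Require Import Defs.
From mathcomp Require Import all_boot all_order all_algebra all_field.
From mathcomp Require Import zify ring.

Set Implicit Arguments.
Unset Strict Implicit.
Unset Printing Implicit Defensive.

Import Order.TTheory GRing.Theory Num.Theory.
Local Open Scope ring_scope.

(** Over a field of characteristic 2 the maps x |-> x^2 and x |-> x^4 are
    additive, so x^7 = x^4 x^2 x turns the exponent of N^{(x) n} on a codeword
    into a cubic form in the coefficients, with the sums
    [\sum_i g_(a,i)^4 g_(b,i)^2 g_(c,i)] as structure constants.  When these form
    a diagonal tensor supported on the logical rows, the exponent on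
    |u G_logical + g> is [\sum_a u_a^7], and pairing a vanishing combination of
    rows with g_a^4 g_a^2 kills its coefficient on the logical row a.

    For the matrix G, let p be the least block index among the three rows.
    Blocks before p contribute 6 = 0, blocks after p contribute 0, and block p
    contributes the sum of (alpha^m)^j over 1 <= j <= 6, that is 1 unless 7
    divides m.  Here m = 4 e_a + 2 e_b + e_c, where e is 2 or 1 for a row of M
    and 0 for a row of S; thus 7 | m only for m = 7 and m = 14, when all three e
    agree and are nonzero.  The column of L equal to (1 1)^T adds 1. *)

(** * Arithmetic in the field with eight elements *)

Lemma F8_pchar2 (F : finFieldType) : #|F| = 8%N -> 2 \in [pchar F].
Proof. by move=> cardF; apply: (@card_finPcharP F 2 3). Qed.

Lemma F8_expf7 (F : finFieldType) (x : F) :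
  #|F| = 8%N -> x != 0 -> x ^+ 7 = 1.
Proof.
move=> cardF x0; apply: (mulfI x0).
by rewrite -exprS mulr1 -cardF expf_card.
Qed.

Lemma pow7E (F : finFieldType) (x : F) : #|F| = 8%N -> pow7 x = (x != 0).
Proof.
move=> cardF; rewrite /pow7; have [->|x0] := eqVneq x 0.
  by rewrite expr0n eq_sym oner_eq0.
by rewrite F8_expf7 // eqxx.
Qed.

Lemma natr_pow7 (F : finFieldType) (x : F) :
  #|F| = 8%N -> (pow7 x)%:R = x ^+ 7.
Proof.
move=> cardF; rewrite pow7E //; have [->|x0] := eqVneq x 0.
  by rewrite expr0n.
by rewrite F8_expf7.
Qed.

(** * Seventh powers of codewords and the cubic form *)

Lemma sqr_sum_pchar2 (R : comNzRingType) (I : finType) (f : I -> R) :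
  2 \in [pchar R] -> (\sum_i f i) ^+ 2 = \sum_i f i ^+ 2.
Proof.
move=> ch2; rewrite -(pFrobenius_autE ch2) rmorph_sum /=.
by apply: eq_bigr => i _; rewrite pFrobenius_autE.
Qed.

Definition cubic_form (F : finFieldType) (m n : nat) (G : 'M[F]_(m, n))
    (a b c : 'I_m) : F :=
  \sum_(i < n) G a i ^+ 4 * G b i ^+ 2 * G c i.

Lemma sum_exp7_mulmx (F : finFieldType) (m n : nat) (G : 'M[F]_(m, n))
    (v : 'rV[F]_m) :
  2 \in [pchar F] ->
  \sum_i (v *m G) 0 i ^+ 7
  = \sum_a \sum_b \sum_c v 0 a ^+ 4 * v 0 b ^+ 2 * v 0 c * cubic_form G a b c.
Proof.
move=> ch2.
transitivity (\sum_i \sum_a \sum_b \sum_c v 0 a ^+ 4 * v 0 b ^+ 2 * v 0 c *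
                (G a i ^+ 4 * G b i ^+ 2 * G c i)).
  (* The exponent 7 is split as 4 + 2 + 1, and 4 as 2 * 2, so that additivity of squaring
     suffices. *)
  apply: eq_bigr => i _; rewrite (exprD _ 4 3) (exprD _ 2 1) expr1 mulrA.
  rewrite (exprM _ 2 2) mxE !sqr_sum_pchar2 // big_distrlr /= mulr_suml.
  apply: eq_bigr => a _; rewrite big_distrlr /=.
  apply: eq_bigr => b _; apply: eq_bigr => c _.
  by ring.
rewrite exchange_big; apply: eq_bigr => a _.
rewrite exchange_big; apply: eq_bigr => b _.
rewrite exchange_big; apply: eq_bigr => c _.
by rewrite mulr_sumr.
Qed.

Definition diagonal_cubic_form (F : finFieldType) (n k' s : nat)
    (G : 'M[F]_(k' + s, n)) : Prop :=
  forall a b c : 'I_(k' + s), cubic_form G a b c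
    = if [&& a == b, b == c & (a < k')%N] then 1 else 0.

(** Every term involving a stabilizer row vanishes, so [w] drops out: all kets of one logical state
    get the same phase. *)
Lemma sum_exp7_diagonal (F : finFieldType) (n k' s : nat)
    (G : 'M[F]_(k' + s, n)) (u : 'rV[F]_k') (w : 'rV[F]_s) :
  2 \in [pchar F] -> diagonal_cubic_form G ->
  \sum_i (row_mx u w *m G) 0 i ^+ 7 = \sum_a u 0 a ^+ 7.
Proof.
move=> ch2 diagG; rewrite sum_exp7_mulmx // big_split_ord /= [X in _ + X]big1.
  rewrite addr0; apply: eq_bigr => a _.
  rewrite (bigD1 (lshift s a)) //= (bigD1 (lshift s a)) //= !big1 ?addr0.
  - by rewrite diagG !eqxx /= ltn_ord row_mxEl mulr1 -!exprD -exprSr.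
  - move=> b /negPf nab; apply: big1 => c _.
    by rewrite diagG eq_sym nab mulr0.
  - by move=> c /negPf nac; rewrite diagG eqxx eq_sym nac mulr0.
move=> a _; apply: big1 => b _; apply: big1 => c _.
by rewrite diagG /= ltnNge leq_addr !andbF mulr0.
Qed.

(** The form vanishes as soon as a stabilizer row enters, so it detects only the logical
    coefficients; the others are killed by the independence of the stabilizer rows. *)
Lemma row_free_diagonal (F : finFieldType) (n k' s : nat)
    (G : 'M[F]_(k' + s, n)) :
  diagonal_cubic_form G -> row_free (dsubmx G) -> row_free G.
Proof.
move=> diagG freeG; apply: inj_row_free => v vG0.
have v_logical (a : 'I_(k' + s)) : (a < k')%N -> v 0 a = 0.
  move=> lt_a.
  have: \sum_i G a i ^+ 4 * G a i ^+ 2 * (v *m G) 0 i = 0.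
    by apply: big1 => i _; rewrite vG0 mxE mulr0.
  rewrite (eq_bigr (fun i => \sum_c v 0 c * (G a i ^+ 4 * G a i ^+ 2 * G c i))).
    rewrite exchange_big /= (bigD1 a) //= [X in _ + X]big1 => [|c /negPf nca].
      by rewrite -mulr_sumr -/(cubic_form _ _ _ _) diagG !eqxx lt_a mulr1 addr0.
    by rewrite -mulr_sumr -/(cubic_form _ _ _ _) diagG eqxx eq_sym nca mulr0.
  move=> i _; rewrite mxE mulr_sumr; apply: eq_bigr => c _.
  by rewrite mulrCA.
have lv0 : lsubmx v = 0.
  by apply/rowP => a; rewrite !mxE v_logical //= ltn_ord.
have rv0 : rsubmx v = 0.
  apply: (row_free_inj freeG); rewrite mul0mx.
  by rewrite -vG0 -{2}[v]hsubmxK -{2}[G]vsubmxK mul_row_col lv0 mul0mx add0r.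
by rewrite -[v]hsubmxK lv0 rv0 row_mx0.
Qed.

(** * The norm gate on code states *)

Lemma tensor_pow_gate_NE (C : numClosedFieldType) (F : finFieldType) (n : nat)
    (x y : 'rV[F]_n) :
  tensor_pow (gate_N C F) x y
  = (-1) ^+ (\sum_i pow7 (y 0%R i)) * (x == y)%:R.
Proof.
rewrite /tensor_pow /gate_N big_split /= prodrXr; congr (_ * _).
have [->|neq_xy] := eqVneq x y; first by apply: big1 => i _; rewrite eqxx.
have [i neq_i] : exists i, x 0 i != y 0 i.
  apply/existsP; apply: contraR neq_xy => /existsPn eq_xy.
  by apply/eqP/rowP => i; apply/eqP/negPn/eq_xy.
by rewrite (bigD1 i) //= (negPf neq_i) mul0r.
Qed.

Lemma acts_as_logical_N_diagonal (C : numClosedFieldType) (F : finFieldType)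
    (n k' s : nat) (G : 'M[F]_(k' + s, n)) :
  #|F| = 8%N -> diagonal_cubic_form G -> acts_as_logical_N C G.
Proof.
move=> cardF diagG u; apply/ffunP => x; have ch2 := F8_pchar2 cardF.
rewrite !ffunE (bigD1 x) //= tensor_pow_gate_NE eqxx mulr1 [X in _ + X]big1; last first.
  move=> y /negPf neq_yx; rewrite tensor_pow_gate_NE eq_sym neq_yx.
  by rewrite mulr0 mul0r.
rewrite addr0 !ffunE !sum_ffunE -![_ *: _]/(_ * _) !(mulrCA (_ ^+ _) _ (\sum_(_ in _) _)).
congr (_ * _); rewrite !mulr_sumr.
apply: eq_bigr => g; rewrite inE => /submxP[w ->]; rewrite ffunE.
case: eqP => [->|_]; last by rewrite !mulr0.
(* Only the parity of the exponents of -1 matters, and in characteristic 2 it can be read off from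
   their images in [F]. *)
rewrite -mul_row_col vsubmxK !mulr1 -signr_odd -[RHS]signr_odd.
congr (_ ^+ nat_of_bool _); apply: negb_inj; rewrite -!dvdn2.
rewrite !(dvdn_pcharf ch2) !natr_sum.
under eq_bigr do rewrite natr_pow7 //.
by under [in RHS]eq_bigr do rewrite natr_pow7 //; rewrite sum_exp7_diagonal.
Qed.

(** * The norm gate on three qubits *)

Lemma from_bits_eq0 (F : finFieldType) (e : 'I_3 -> F) (b : 'rV[bool]_3) :
  F2_basis e -> (from_bits e b == 0) = [forall i, ~~ b 0 i].
Proof.
move=> /bij_inj inj_e.
have e0 : from_bits e (const_mx false) = 0.
  by apply: big1 => i _; rewrite mxE mul0r.
rewrite -e0 (inj_eq inj_e); apply/eqP/forallP => [-> i | b0].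
  by rewrite mxE.
by apply/rowP => i; rewrite mxE; apply/negbTE.
Qed.

Lemma tensor_pow_gate_XE (C : numClosedFieldType) (n : nat)
    (x y : 'rV[bool]_n) :
  tensor_pow (gate_X C) x y = (x == map_mx negb y)%:R.
Proof.
rewrite /tensor_pow /gate_X; have [->|neq_xy] := eqVneq x.
  by apply: big1 => i _; rewrite mxE eqxx.
have [i neq_i] : exists i, x 0 i != ~~ y 0 i.
  apply/existsP; apply: contraR neq_xy => /existsPn eq_xy.
  by apply/eqP/rowP => i; rewrite mxE; apply/eqP/negPn/eq_xy.
by rewrite (bigD1 i) //= (negPf neq_i) mul0r.
Qed.

(** N negates every basis state except zero, whereas CCZ conjugated by X negates only the all-zero
    word; hence the global phase -1. *)
Lemma gate_N_on_qubits (C : numClosedFieldType) (F : finFieldType)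
    (e : 'I_3 -> F) :
  #|F| = 8%N -> F2_basis e ->
  eq_up_to_phase (on_qubits e (gate_N C F))
    (comp_op (tensor_pow (gate_X C))
       (comp_op (gate_CCZ C) (tensor_pow (gate_X C)))).
Proof.
move=> cardF e_basis; exists (-1); split; first by rewrite normrN1.
have negK : involutive (map_mx negb : 'rV[bool]_3 -> 'rV[bool]_3).
  by move=> z; apply/rowP => i; rewrite !mxE negbK.
move=> x y; rewrite /comp_op (bigD1 (map_mx negb x)) //=.
rewrite [X in _ + X]big1 ?addr0 => [|z neq_z]; last first.
  rewrite tensor_pow_gate_XE -(inv_eq negK) eq_sym.
  by rewrite (negPf neq_z) mul0r.
rewrite tensor_pow_gate_XE negK eqxx mul1r (bigD1 (map_mx negb y)) //=.
rewrite [X in _ + X]big1 ?addr0 => [|z neq_z]; last first.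
  by rewrite tensor_pow_gate_XE (negPf neq_z) mulr0.
rewrite tensor_pow_gate_XE eqxx mulr1 /gate_CCZ (inj_eq (inv_inj negK)).
rewrite /on_qubits /gate_N (inj_eq (bij_inj e_basis)) mulrA; congr (_ * _).
rewrite pow7E // from_bits_eq0 //.
under [in RHS]eq_forallb do rewrite mxE.
by case: [forall i, _]; rewrite ?expr1 ?expr0 ?mulN1r ?opprK.
Qed.

(** * The Z-distance *)

(** The witness is the sum of the unit vectors at [i] and [j]. A vector supported on one position
    and orthogonal to row [r], which has no zero entry, must be zero. *)
Lemma Z_distance_is_2 (F : finFieldType) (n k' s : nat)
    (G : 'M[F]_(k' + s, n)) (a : 'I_k') (r : 'I_s) (i j : 'I_n) :
  (forall c, G (rshift k' r) c != 0) ->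
  i != j ->
  (forall t, G (rshift k' t) i + G (rshift k' t) j = 0) ->
  G (lshift s a) i + G (lshift s a) j != 0 -> Z_distance_is G 2.
Proof.
move=> Gr_neq0 neq_ij stab_ij log_ij.
have sum_ij t : \sum_c (delta_mx 0 i + delta_mx 0 j : 'rV[F]_n) 0 c * G t c
    = G t i + G t j.
  rewrite (bigD1 i) //= (bigD1 j) 1?eq_sym //= big1 ?addr0.
    by rewrite !mxE !eqxx [j == i]eq_sym (negPf neq_ij) addr0 add0r !mul1r.
  move=> c /andP[/negPf nci /negPf ncj].
  by rewrite !mxE nci ncj addr0 mul0r.
split.
  exists (delta_mx 0 i + delta_mx 0 j).
    split=> [t|]; first by rewrite /orthogonal_row sum_ij.
    by exists a; rewrite /orthogonal_row sum_ij; apply/eqP.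
  transitivity #|[set i; j]|; last by rewrite cards2 neq_ij.
  apply: eq_card => c; rewrite !inE !mxE /=.
  have [->|nci] := eqVneq c i.
    by rewrite (negPf neq_ij) addr0 oner_neq0.
  by case: (c == j); rewrite add0r ?oner_neq0 ?eqxx.
move=> z [stab_z [b log_z]]; rewrite leqNgt; apply/negP => wt_z.
(* The support lies in a single position [c]; for z = 0 the position [i] serves as default. *)
have [c zc] : exists c, forall d, d != c -> z 0 d = 0.
  have [supp0|[c]] := set_0Vmem [set d | z 0 d != 0].
    exists i => d _; apply/eqP/negbNE; apply/negP => zd.
    by have := in_set0 d; rewrite -supp0 inE zd.
  move=> supp_c; exists c => d ndc; apply/eqP/negbNE; apply/negP => zd.
  have: (#|[set c; d]| <= hamming_weight z)%N.
    by apply/subset_leq_card/subsetP => x /set2P[]->; rewrite // inE.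
  by rewrite cards2 eq_sym ndc => /leq_ltn_trans/(_ wt_z).
have sum_c t : \sum_d z 0 d * G t d = z 0 c * G t c.
  by rewrite (bigD1 c) //= big1 ?addr0 // => d /zc ->; rewrite mul0r.
apply: log_z; have := stab_z r; rewrite /orthogonal_row !sum_c.
by move/eqP; rewrite mulf_eq0 (negPf (Gr_neq0 c)) orbF => /eqP ->; rewrite mul0r.
Qed.

(** * Powers of [alpha] and the entries of G *)

(** The order divides the prime 7 and is not 1, as neither 0 nor 1 satisfies the cubic equation. *)
Lemma primitive7_alpha (F : finFieldType) (alpha : F) :
  #|F| = 8%N -> alpha ^+ 3 = alpha + 1 -> 7.-primitive_root alpha.
Proof.
move=> cardF alpha_eq.
have alpha0 : alpha != 0.
  apply: contra_eq_neq alpha_eq => ->.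
  by rewrite expr0n add0r eq_sym oner_neq0.
have alpha1 : alpha != 1.
  apply: contra_eq_neq alpha_eq => ->.
  by rewrite expr1n -{1}[1]addr0 (inj_eq (addrI 1)) eq_sym oner_neq0.
have [//|m prim_m dvd_m7] := prim_order_exists _ (F8_expf7 cardF alpha0).
have m1 : m != 1%N.
  apply: contraNneq alpha1 => m1.
  by rewrite -[alpha]expr1 -(prim_order_dvd prim_m) m1.
by have/prime_nt_dvdP := dvd_m7 => <-.
Qed.

(** For x = 1 the sum is 6 = 0. Otherwise the powers with exponents 0 to 6 sum to 0, which leaves -1
    = 1. *)
Lemma sum_powers_F8 (F : finFieldType) (x : F) :
  #|F| = 8%N -> x != 0 -> \sum_(j < 6) x ^+ j.+1 = (x != 1)%:R.
Proof.
move=> cardF x0; have ch2 := F8_pchar2 cardF.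
have [->|x1] := eqVneq x 1.
  under eq_bigr do rewrite expr1n.
  by rewrite sumr_const card_ord; apply/eqP; rewrite -(dvdn_pcharf ch2).
have: (x - 1) * (\sum_(j < 7) x ^+ j) == 0.
  by rewrite -subrX1 F8_expf7 // subrr.
rewrite mulf_eq0 subr_eq0 (negPf x1) big_ord_recl expr0 addr_eq0 /=.
by rewrite (oppr_pchar2 ch2) => /eqP.
Qed.

(* The stabilizer row r = 2k is the row of a k-th block row, of which only the
   S blocks are visible; the exponent of alpha is 0 inside an S block. *)
Definition row_entry (F : finFieldType) (alpha : F) (k r c : nat) : F :=
  if c == 0%N then (r == (2 * k)%N)%:R else if c == 1%N then 1 else
  let p := (r %/ 2)%N in let q := ((c - 2) %/ 6)%N in
  if (q <= p)%N then
    alpha ^+ ((q == p) * (2 - r %% 2) * ((c - 2) %% 6).+1)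
  else 0.

Lemma GmatrixE (F : finFieldType) (alpha : F) (k : nat)
    (r : 'I_(2 * k + 1)) (c : 'I_(6 * k + 2)) :
  Gmatrix alpha k r c = row_entry alpha k r c.
Proof.
have lt_c := ltn_ord c; rewrite mxE /row_entry.
case: split_ordP => [a ->|a ->] /=; rewrite !mxE.
  have lt_a := ltn_ord a; rewrite (ltn_eqF lt_a).
  have lt_a2 : (a %% 2 < 2)%N by rewrite ltn_mod.
  have lt_c6 : ((c - 2) %% 6 < 6)%N by rewrite ltn_mod.
  case: ifP => [lt_c2|/negbT ge_c2].
    rewrite -val_eqE /= inordK //.
    by case: (nat_of_ord c) lt_c2 => [|[|]].
  have -> : (c == 0%N :> nat) = false by lia.
  have -> : (c == 1%N :> nat) = false by lia.
  rewrite /=; have [_|_|_] := ltngtP ((c - 2) %/ 6)%N (a %/ 2)%N.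
  - by rewrite !mul0n expr0.
  - by [].
  (* The two rows of M have exponent steps 2 and 1, that is [2 - a %% 2]. *)
  rewrite mul1n -val_eqE /= !inordK //.
  by case: (a %% 2)%N lt_a2 => [|[|]] //= _; rewrite subn1 mul1n.
(* The stabilizer row has block index [k], and every block column lies strictly before it, so its
   entries there are [alpha ^+ 0]. *)
rewrite ord1 addn0 eqxx; case: eqP => // /eqP c0; case: eqP => // /eqP c1.
by rewrite mulKn // ltnW ?ltn_eqF ?mul0n ?ltn_divLR //; lia.
Qed.

(** * The cubic form of G, block by block *)

Lemma sum_columns (R : nmodType) (k : nat) (f : nat -> R) :
  \sum_(c < 6 * k + 2) f c
  = f 0%N + f 1%N + \sum_(q < k) \sum_(j < 6) f (q * 6 + j + 2)%N.
Proof.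
rewrite addn2 !big_ord_recl addrA; congr (_ + _).
rewrite mulnC -(big_mkord xpredT (fun i => f i.+2)) big_nat_mul big_mkord.
apply: eq_bigr => q _; rewrite -{1}[(q * 6)%N]add0n big_addn mulSn addnK.
by rewrite big_mkord; apply: eq_bigr => j _; rewrite addn2 addnC.
Qed.

Lemma row_entry_block (F : finFieldType) (alpha : F) (k r q : nat) (j : 'I_6) :
  row_entry alpha k r (q * 6 + j + 2)
  = if (q <= r %/ 2)%N then alpha ^+ ((q == r %/ 2)%N * (2 - r %% 2) * j.+1)
    else 0.
Proof.
rewrite /row_entry addnK divnMDl // divn_small // addn0.
by rewrite addn2 modnMDl (modn_small (ltn_ord j)).
Qed.

(** Unless one row is zero on block [q], the j-th product is the j-th power of alpha^m with m the
    weight shown, and alpha^m = 1 exactly when 7 divides m. *)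
Lemma block_cubic_sum (F : finFieldType) (alpha : F) (k q a b c : nat) :
  #|F| = 8%N -> 7.-primitive_root alpha ->
  \sum_(j < 6) row_entry alpha k a (q * 6 + j + 2) ^+ 4
    * row_entry alpha k b (q * 6 + j + 2) ^+ 2
    * row_entry alpha k c (q * 6 + j + 2)
  = [&& q <= a %/ 2, q <= b %/ 2, q <= c %/ 2 &
       ~~ (7 %| 4 * ((q == a %/ 2) * (2 - a %% 2))
              + 2 * ((q == b %/ 2) * (2 - b %% 2))
              + (q == c %/ 2) * (2 - c %% 2))]%N%:R.
Proof.
move=> cardF prim_alpha; under eq_bigr do rewrite !row_entry_block.
case: (_ <= a %/ 2)%N; last by apply: big1 => j _; rewrite expr0n !mul0r.
case: (_ <= b %/ 2)%N; last by apply: big1 => j _; rewrite expr0n mulr0 mul0r.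
case: (_ <= c %/ 2)%N; last by apply: big1 => j _; rewrite mulr0.
rewrite /= (prim_order_dvd prim_alpha) -sum_powers_F8 //.
  apply: eq_bigr => j _; rewrite -!exprM -!exprD; congr (_ ^+ _); lia.
apply: expf_neq0; apply: contra_eq_neq (prim_expr_order prim_alpha) => ->.
by rewrite expr0n eq_sym oner_neq0.
Qed.

Lemma eqn_div_mod2 (a b : nat) :
  (a == b) = ((a %/ 2 == b %/ 2) && (a %% 2 == b %% 2))%N.
Proof. by lia. Qed.

(** The hypothesis allows equal rows to have nonzero weight only, and excludes the total 0. With
    weights in {0, 1, 2}, the totals 7 and 14 arise only from equal weights, which then fix block
    and parity. *)
Lemma seven_dvd_weights (p a b c : nat) :
  [|| p == a %/ 2, p == b %/ 2 | p == c %/ 2]%N ->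
  (7 %| 4 * ((p == a %/ 2) * (2 - a %% 2))
      + 2 * ((p == b %/ 2) * (2 - b %% 2))
      + (p == c %/ 2) * (2 - c %% 2))%N = (a == b) && (b == c).
Proof.
rewrite (eqn_div_mod2 a b) (eqn_div_mod2 b c).
have: (a %% 2 < 2)%N by rewrite ltn_mod.
have: (b %% 2 < 2)%N by rewrite ltn_mod.
have: (c %% 2 < 2)%N by rewrite ltn_mod.
case: (a %% 2)%N => [|[|]] //; case: (b %% 2)%N => [|[|]] //;
  case: (c %% 2)%N => [|[|]] // _ _ _;
  move: (a %/ 2)%N (b %/ 2)%N (c %/ 2)%N => x y z;
  have [hx|hx] := eqVneq p x; have [hy|hy] := eqVneq p y;
  have [hz|hz] := eqVneq p z; rewrite //= => _; lia.
Qed.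

Lemma Gmatrix_diagonal (F : finFieldType) (alpha : F) (k : nat) :
  #|F| = 8%N -> alpha ^+ 3 = alpha + 1 ->
  diagonal_cubic_form (Gmatrix alpha k).
Proof.
move=> cardF alpha_eq a b c; have ch2 := F8_pchar2 cardF.
have prim_alpha := primitive7_alpha cardF alpha_eq.
rewrite /cubic_form; under eq_bigr do rewrite !GmatrixE.
rewrite (sum_columns k (fun i => row_entry alpha k a i ^+ 4 *
  row_entry alpha k b i ^+ 2 * row_entry alpha k c i)).
under eq_bigr do rewrite block_cubic_sum //.
have [lt_a lt_b lt_c] : [/\ a < 2 * k + 1, b < 2 * k + 1 & c < 2 * k + 1]%N.
  by split; apply: ltn_ord.
rewrite -!val_eqE /= {1 2 3 4 5 6}/row_entry /= !expr1n !mulr1.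
move: (nat_of_ord a) (nat_of_ord b) (nat_of_ord c) lt_a lt_b lt_c.
move=> {}a {}b {}c lt_a lt_b lt_c.
set p := minn (a %/ 2) (minn (b %/ 2) (c %/ 2)).
(* If p = k, all three rows are the stabilizer row: columns 0 and 1 cancel and each block gives 6 =
   0. *)
have [lt_pk|le_kp] := ltnP p k; last first.
  have -> : a = (2 * k)%N by lia.
  have -> : b = (2 * k)%N by lia.
  have -> : c = (2 * k)%N by lia.
  rewrite !eqxx ltnn !expr1n !mulr1 (addrr_pchar2 ch2) add0r big1 // => q _.
  by rewrite mulKn // ltn_eqF //= !andbF.
(* Column 0 is nonzero only in the stabilizer row, and some row here is logical. *)
have -> : (a == (2 * k)%N)%:R ^+ 4 * (b == (2 * k)%N)%:R ^+ 2
    * (c == (2 * k)%N)%:R = 0 :> F.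
  have [a2k|] := eqVneq a; last by rewrite expr0n !mul0r.
  have [b2k|] := eqVneq b; last by rewrite expr0n mulr0 mul0r.
  have [c2k|] := eqVneq c; last by rewrite mulr0.
  by lia.
have [le_pa le_pb le_pc] : [/\ p <= a %/ 2, p <= b %/ 2 & p <= c %/ 2]%N.
  by split; lia.
rewrite add0r (bigD1 (Ordinal lt_pk)) //= [X in _ + (_ + X)]big1 => [|q neq_q].
  (* Column 1 always gives 1; block [p] cancels it unless the three rows coincide. *)
  rewrite addr0 le_pa le_pb le_pc seven_dvd_weights; last by lia.
  have [eq_ab|_] /= := eqVneq a b; last by rewrite (addrr_pchar2 ch2).
  have [eq_bc|_] /= := eqVneq b c; last by rewrite (addrr_pchar2 ch2).
  have -> : (a < 2 * k)%N by lia.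
  by rewrite addr0.
have neq_qp : nat_of_ord q != p by rewrite -val_eqE in neq_q.
(* A block other than [p] meeting all three bounds lies strictly before [p], so its weights are 0,
   and 7 divides 0. *)
case: and4P => // -[le_qa le_qb le_qc].
have [lt_qa lt_qb lt_qc] : [/\ q < a %/ 2, q < b %/ 2 & q < c %/ 2]%N.
  by split; lia.
by rewrite !ltn_eqF.
Qed.

(** * The distillation protocol *)

Theorem mainTheorem5 (C : numClosedFieldType) (F : finFieldType) (alpha : F)
    (cardF : #|F| = 8%N) (alpha_eq : alpha ^+ 3 = alpha + 1)
    (k : nat) (k_ge1 : (1 <= k)%N) :
  let G := Gmatrix alpha k in
  [/\ CCZ_protocol C (6 * k + 2) (2 * k) 2 G,
      (forall a b c : 'I_(2 * k + 1),
        \sum_(i < 6 * k + 2) (G a i) ^+ 4 * (G b i) ^+ 2 * G c i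
        = if [&& a == b, b == c & (a < 2 * k)%N] then 1 else 0)
    & (forall e : 'I_3 -> F, F2_basis e ->
        eq_up_to_phase (on_qubits e (gate_N C F))
          (comp_op (tensor_pow (gate_X C))
             (comp_op (gate_CCZ C) (tensor_pow (gate_X C)))))].
Proof.
move=> G; have diagG : diagonal_cubic_form G by apply: Gmatrix_diagonal.
split; [split | exact: diagG | by move=> e; apply: gate_N_on_qubits].
- apply: row_free_diagonal diagG _; rewrite col_mxKd.
  apply: inj_row_free => v /rowP/(_ (rshift (6 * k) 0)).
  by rewrite !mxE big_ord1 mxE mulr1 => v0; apply/rowP => i; rewrite ord1 v0 mxE.
- exact: acts_as_logical_N_diagonal.
have lt0 : (0 < 6 * k + 2)%N by rewrite addn2.
have lt1 : (1 < 6 * k + 2)%N by rewrite addn2.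
have lt_k : (0 < 2 * k)%N by rewrite muln_gt0.
(* On columns 0 and 1 the stabilizer row sums to 1 + 1 = 0 and the first logical row to 0 + 1 =
   1. *)
apply: (@Z_distance_is_2 _ _ _ _ _ (Ordinal lt_k) 0 (Ordinal lt0) (Ordinal lt1)).
- by move=> c; rewrite col_mxEd mxE oner_neq0.
- by [].
- by move=> t; rewrite !col_mxEd !mxE (addrr_pchar2 (F8_pchar2 cardF)).
by rewrite !GmatrixE /row_entry /= (ltn_eqF lt_k) add0r oner_neq0.
Qed.
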